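(* For any integer $k\geq2$, the interval $\mathbf{I}(W^{k})$ is finite and has at least $k+1$ elements.
   Context: $\Omega$ is the set of all Boolean functions $f\colon\{0,1\}^n\to\{0,1\}$, $n\ge 1$. An $m$-ary $g$ is a subfunction of an $n$-ary $f$ if there is a map $\sigma\colon\{1,\dots,n\}\to\{1,\dots,m\}$ with $g(x_1,\dots,x_m)=f(x_{\sigma(1)},\dots,x_{\sigma(n)})$ identically. An equational class is a set $\mathcal{K}\subseteq\Omega$ (possibly empty) such that every subfunction of a member of $\mathcal{K}$ is in $\mathcal{K}$. For an $n$-ary $f$ and $m$-ary $g_1,\dots,g_n$, the composition $f(g_1,\dots,g_n)$ is the $m$-ary function $\mathbf{a}\mapsto f(g_1(\mathbf{a}),\dots,g_n(\mathbf{a}))$; $\mathcal{K}$ is composition-closed if all compositions $f(g_1,\dots,g_n)$ with $f,g_1,\dots,g_n\in\mathcal{K}$ ($g_i$ of equal arity) belong to $\mathcal{K}$. A clone is a composition-closed subset of $\Omega$ containing all projections; $[\mathcal{K}]$ is the smallest clone containing $\mathcal{K}$. $\mathbf{I}$ is the set of all composition-closed equational classes, and $\mathbf{I}(\mathcal{C})=\{\mathcal{K}\in\mathbf{I}:[\mathcal{K}]=\mathcal{C}\}$ (an interval of the lattice $(\mathbf{I};\subseteq)$). An $n$-ary $f$ preserves a relation $P\subseteq\{0,1\}^k$ if applying $f$ coordinatewise to any $n$ members of $P$ gives a member of $P$. For an integer $k\ge2$, $W^k$ is the clone of functions preserving $\{0,1\}^k\setminus\{\mathbf{0}\}$, where $\mathbf{0}=(0,\dots,0)$.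 *)

(* Defs.v *)
From mathcomp Require Import all_boot.
From mathcomp Require Import boolp classical_sets cardinality.

Set Implicit Arguments.
Unset Strict Implicit.
Unset Printing Implicit Defensive.

Local Open Scope classical_set_scope.

Definition boolfun (n : nat) := {ffun bool ^ n -> bool}.

(* Functions carry their arity: functions of different arities are distinct
   elements of Omega.  There are no nullary functions: [omega f] is f viewed
   as a member of Omega, for f of positive arity n.+1. *)
Definition Omega : Type := {n : nat & boolfun n.+1}.

Definition omega (n : nat) (f : boolfun n.+1) : Omega :=
  existT (fun n => boolfun n.+1) n f.

Definition arity (f : Omega) : nat := (projT1 f).+1.

Definition fun_of (f : Omega) : boolfun (arity f) := projT2 f.

Definition subfunction (g f : Omega) : Prop :=
  exists sigma : 'I_(arity f) -> 'I_(arity g),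
    forall x : bool ^ (arity g), fun_of g x = fun_of f [ffun i => x (sigma i)].

Definition equational_class (K : set Omega) : Prop :=
  forall f g : Omega, K f -> subfunction g f -> K g.

Definition composition (n m : nat) (f : boolfun n) (g : 'I_n -> boolfun m) :
    boolfun m :=
  [ffun a => f [ffun i => g i a]].

Definition composition_closed (K : set Omega) : Prop :=
  forall (n m : nat) (f : boolfun n.+1) (g : 'I_n.+1 -> boolfun m.+1),
    K (omega f) -> (forall i, K (omega (g i))) -> K (omega (composition f g)).

Definition projection (n : nat) (i : 'I_n) : boolfun n := [ffun x : bool ^ n => x i].

Definition clone (K : set Omega) : Prop :=
  composition_closed K /\
  forall (n : nat) (i : 'I_n.+1), K (omega (projection i)).

Definition clone_generated (K : set Omega) : set Omega := smallest clone K.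

Definition cc_equational_classes : set (set Omega) :=
  [set K | equational_class K /\ composition_closed K].

Definition clone_interval (C : set Omega) : set (set Omega) :=
  [set K | cc_equational_classes K /\ clone_generated K = C].

Definition preserves (k : nat) (f : Omega) (P : set (bool ^ k)) : Prop :=
  forall t : 'I_(arity f) -> bool ^ k,
    (forall j, P (t j)) -> P [ffun i => fun_of f [ffun j => t j i]].

Definition W (k : nat) : set Omega :=
  [set f | preserves f (~` [set ([ffun=> false] : bool ^ k)])].

(* Main.v *)
Require Import Defs.
From mathcomp Require Import all_boot.
From mathcomp Require Import boolp classical_sets cardinality.

Local Open Scope classical_set_scope.
Local Open Scope card_scope.

(** A function belongs to [W k] exactly when any [k] of its zeros vanish at a
common coordinate, so classes of functions are described here through the
zeros of their members.

At least [k+1] classes.  For [j <= k] let [W_ones k j] consist of the members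
of [W k] any [j] zeros of which also take the value 1 at a common coordinate.
If [j] points are zeros of a composition [f(g_1, .., g_n)], a coordinate where
the corresponding zeros of [f] all vanish is an index [i] such that the [j]
points are zeros of [g_i]; hence each [W_ones k j] is composition-closed
([W_ones_cc]).  It generates [W k]: for [f] in [W k], the function that
vanishes exactly at the points [(x, 1)] with [f x = 0] lies in [W_ones k j],
and substituting the constant 1 for its last argument returns [f]
([W_ones_generates]).  Functions with exactly [j] well-chosen zeros separate
these classes ([W_ones_separated]).

Finiteness.  Let [K] be a class that generates [W k].  The point is that [K]
satisfies an interpolation property of Baker-Pixley type: a function that
agrees with members of [K] on any [k] points is in [K]
([interval_interpolation]).  If some member of [K] vanishes at the zero point,
then identifying its variables gives projections, so [K] is the clone [W k]
itself.  Otherwise members of [K] take the value 1 at both constant points.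
Since [K] is not contained in [W k.+1], it has a member [f] with [k+1] zeros
that vanish together at no coordinate.  Splitting the variables of [f] in two
groups shows that [K] is closed under pointwise implication
([implication_closed]), hence under every operation that lies above one of its
arguments, because implication generates these
([implication_closed_W_infty]).  Applying [f] to such operations shows that
[K] is closed under the operation of arity [k+1] telling whether at least two
arguments are 1 ([at_least_two_closed]).  That operation itself need not lie in
[K], but it absorbs one wrong argument among [k+1], which is all that the
Baker-Pixley induction on the number of interpolation points uses.
Finally, [k] points of any cube have at most [2^k] distinct columns, so [K] is
determined by its members of a single arity ([interval_sub_of_trace]). *)

(** * Zeros with a common coordinate *)

Definition zeros_share (b : bool) (k : nat) {n : nat} (f : boolfun n.+1) : Prop :=
  forall x : 'I_k -> bool ^ n.+1, (forall i, f (x i) = false) ->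
    exists c, forall i, x i c = b.

(** The columns of a table of [k] points are the arguments in the definition of
preservation: the columns are all nonzero exactly when the points vanish
together at no coordinate. *)
Lemma W_zeros_shareP (k n : nat) (f : boolfun n.+1) :
  W k (omega f) <-> zeros_share false k f.
Proof.
split=> [Wf x fx0 | share_f t t_neq0 eq0].
- apply: contrapT => no_c.
  apply: (Wf (fun j => [ffun i => x i j])) => [j eq0|].
    apply: no_c; exists j => i.
    by move/ffunP: eq0 => /(_ i); rewrite !ffunE.
  apply/ffunP => i; rewrite !ffunE -[RHS](fx0 i) /=; congr (f _).
  by apply/ffunP => j; rewrite !ffunE.
- have [i|c tc0] := share_f (fun i => [ffun j => t j i]).
    by move/ffunP: eq0 => /(_ i); rewrite !ffunE.
  apply: (t_neq0 c); apply/ffunP => i.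
  by have := tc0 i; rewrite !ffunE.
Qed.

(** Repeating points turns [j] zeros into [k] zeros; for [j = 0] any coordinate
will do, since arities are positive. *)
Lemma zeros_share_le (b : bool) (j k n : nat) (f : boolfun n.+1) :
  j <= k -> zeros_share b k f -> zeros_share b j f.
Proof.
case: j => [_ _ x _|j le_jk share_f x fx0]; first by exists ord0 => -[].
have [i|c xc] := share_f (fun i => x (inord i)); first exact: fx0.
exists c => i; have := xc (widen_ord le_jk i).
by rewrite /= inord_val.
Qed.

Lemma zeros_share_subfunction (b : bool) (k n m : nat) (f : boolfun n.+1)
    (g : boolfun m.+1) :
  subfunction (omega g) (omega f) -> zeros_share b k f -> zeros_share b k g.
Proof.
case=> sigma gE share_f x gx0.
have [i|c xc] := share_f (fun i => [ffun j => x i (sigma j)]).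
  by rewrite -[LHS]gE; apply: gx0.
by exists (sigma c) => i; rewrite -(xc i) ffunE.
Qed.

(** A coordinate [c] where the zeros [(g_l (x i))_l] of [f] all vanish says
that the points [x i] are zeros of [g c], so the property of [g c] decides. *)
Lemma zeros_share_composition (b : bool) (j n m : nat) (f : boolfun n.+1)
    (g : 'I_n.+1 -> boolfun m.+1) :
  zeros_share false j f -> (forall i, zeros_share b j (g i)) ->
  zeros_share b j (composition f g).
Proof.
move=> share_f share_g x fgx0.
have [i|c gc0] := share_f (fun i => [ffun l => g l (x i)]).
  by have := fgx0 i; rewrite ffunE.
by apply: (share_g c) => i; have := gc0 i; rewrite ffunE.
Qed.

Lemma W_clone (k : nat) : clone (W k).
Proof.
split=> [n m f g /W_zeros_shareP fW gW|n i]; apply/W_zeros_shareP.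
  by apply: zeros_share_composition => // i; apply/W_zeros_shareP.
by move=> x x0; exists i => j; have := x0 j; rewrite ffunE.
Qed.

(** * A chain of classes generating W k *)

Definition W_ones (k j : nat) : set Omega :=
  [set f | W k f /\ zeros_share true j (fun_of f)].

Lemma W_ones_cc (k j : nat) : j <= k -> cc_equational_classes (W_ones k j).
Proof.
move=> le_jk; split=> [[n f] [m g] [/W_zeros_shareP fW f1] gf|].
  split; last exact: zeros_share_subfunction gf f1.
  by apply/W_zeros_shareP; apply: zeros_share_subfunction gf fW.
move=> n m f g [fW f1] gK; split.
  by apply: (W_clone k).1 => // i; case: (gK i).
apply: zeros_share_composition => [|i]; last by case: (gK i).
by apply: zeros_share_le le_jk _; apply/W_zeros_shareP.
Qed.

(** A fresh variable equal to 1 at all zeros makes every function of [W k] a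
member of [W_ones k j], and the constant 1, a member too, undoes this. *)
Lemma W_ones_generates (k j : nat) : 0 < k -> clone_generated (W_ones k j) = W k.
Proof.
move=> k_gt0; apply/seteqP; split.
  by apply: smallest_sub (W_clone k) _ => f [].
move=> [n f] /W_zeros_shareP fW C [[C_comp C_proj] K_C].
pose f' : boolfun n.+2 :=
  [ffun x : bool ^ n.+2 => ~~ x ord_max || f [ffun i => x (widen_ord (leqnSn _) i)]].
have f'C : C (omega f').
  apply: K_C; split.
    apply/W_zeros_shareP => x f'x0.
    have [i|c xc] := fW (fun i => [ffun c => x i (widen_ord (leqnSn _) c)]).
      by have := f'x0 i; rewrite ffunE; case/norP => _ /negbTE.
    by exists (widen_ord (leqnSn _) c) => i; have := xc i; rewrite ffunE.
  move=> x f'x0; exists ord_max => i.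
  by have := f'x0 i; rewrite ffunE; case/norP => /negPn.
have oneC : C (omega ([ffun=> true] : boolfun n.+1)).
  apply: K_C; split.
    apply/W_zeros_shareP => x x0.
    by have := x0 (Ordinal k_gt0); rewrite ffunE.
  case: j => [|j] x x0; first by exists ord0 => -[].
  by have := x0 ord0; rewrite ffunE.
pose g (i : 'I_n.+2) : boolfun n.+1 :=
  if insub (val i) is Some i' then projection i' else [ffun=> true].
have -> : existT _ n f = omega (composition f' g).
  congr existT; apply/ffunP => x; rewrite !ffunE {1}/g insubN ?ltnn // ffunE /=.
  congr (f _); apply/ffunP => i; rewrite !ffunE /g /= valK.
  by rewrite ffunE.
by apply: C_comp => // i; rewrite /g; case: insubP => // i' _ _.
Qed.


(** * Separating examples *)

Definition vanishing_on {m n : nat} (a : 'I_m -> bool ^ n.+1) : boolfun n.+1 :=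
  [ffun x => x \notin codom a].

Lemma vanishing_onP (m n : nat) (a : 'I_m -> bool ^ n.+1) (x : bool ^ n.+1) :
  vanishing_on a x = false -> exists i, x = a i.
Proof. by rewrite ffunE => /negbFE/codomP. Qed.

(** Fewer than [m] zeros omit some [a l], so it suffices that all the [a i]
but one share a coordinate. *)
Lemma vanishing_on_share (b : bool) (j m n : nat) (a : 'I_m -> bool ^ n.+1) :
  j < m -> (forall l, exists c, forall i, i != l -> a i c = b) ->
  zeros_share b j (vanishing_on a).
Proof.
move=> lt_jm a_share x x0.
have [u xE] := fin_all_exists (fun i => vanishing_onP _ _ _ _ (x0 i)).
have /existsP[l l_u] : [exists l, l \notin codom u].
  rewrite -negb_forall; apply/negP => /forallP u_surj.
  have : #|'I_m| <= #|'I_j|.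
    apply: leq_trans (leq_image_card u predT).
    by apply: subset_leq_card; apply/fintype.subsetP => l _; apply: u_surj.
  by rewrite !card_ord leqNgt lt_jm.
have [c ac] := a_share l; exists c => i; rewrite xE; apply: ac.
by apply: contraNneq l_u => <-; apply: codom_f.
Qed.

Lemma vanishing_on_not_share (b : bool) (m n : nat) (a : 'I_m -> bool ^ n.+1) :
  (forall c, exists i, a i c = ~~ b) -> ~ zeros_share b m (vanishing_on a).
Proof.
move=> a_miss /(_ a)[i|c ac].
  by rewrite ffunE; apply/negbTE/negPn/codom_f.
by have [i] := a_miss c; rewrite ac; case: b {a_miss ac}.
Qed.

(** The unit vectors of dimension [k+1]: all but the one of index [l] vanish at
coordinate [l], while together they vanish nowhere. *)
Lemma W_strict (k : nat) : ~ W k `<=` W k.+1.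
Proof.
pose a (i : 'I_k.+1) : bool ^ k.+1 := [ffun c : 'I_k.+1 => c == i].
move=> /(_ (omega (vanishing_on a))) sub.
have /sub/W_zeros_shareP : W k (omega (vanishing_on a)).
  apply/W_zeros_shareP; apply: vanishing_on_share (ltnSn k) _ => l.
  by exists l => i; rewrite ffunE eq_sym => /negbTE.
by apply: vanishing_on_not_share => c; exists c; rewrite ffunE eqxx.
Qed.

(** The witness vanishes at the complements of the unit vectors of dimension
[m], extended by a last coordinate equal to 0: the last coordinate keeps it in
[W k], and coordinate [l] is 1 on all these points but one. *)
Lemma W_ones_separated (k j m : nat) : j < m -> W_ones k j <> W_ones k m.
Proof.
move=> lt_jm eqK.
pose a (i : 'I_m) : bool ^ m.+1 := [ffun c : 'I_m.+1 => (c < m) && (val c != i)].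
have: W_ones k j (omega (vanishing_on a)).
  split; last first.
    apply: vanishing_on_share lt_jm _ => l; exists (widen_ord (leqnSn _) l) => i.
    by rewrite ffunE /= ltn_ord eq_sym.
  apply/W_zeros_shareP => x x0; exists ord_max => i.
  by have [l ->] := vanishing_onP _ _ _ _ (x0 i); rewrite ffunE ltnn.
rewrite eqK => -[_]; apply: vanishing_on_not_share => c.
have [lt_cm | le_mc] := ltnP c m.
  by exists (Ordinal lt_cm); rewrite ffunE eqxx andbF.
by exists (Ordinal lt_jm); rewrite ffunE ltnNge le_mc.
Qed.

(** * Closure properties of the classes generating W k *)

(** In terms of zero sets, [f ==> g] is the difference of the zero set of [g]
and that of [f], and applying it twice, as [(f ==> g) ==> g], gives the
intersection.  From the half-cubes [x c = 0] these produce every singleton of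
the half-cube [x i = 0], and removing singletons from that half-cube leaves an
arbitrary subset of it. *)
Lemma implication_closed_W_infty (m : nat) (A : set (boolfun m)) :
  (forall i, A (projection i)) ->
  (forall f g, A f -> A g -> A [ffun x => f x ==> g x]) ->
  forall (i : 'I_m) (f : boolfun m), (forall x : bool ^ m, x i -> f x) -> A f.
Proof.
move=> A_proj A_imp i f le_if.
have A_point (p : bool ^ m) : p i = false -> A [ffun x => x != p].
  move=> pi0.
  (* Zero set: the points of the half-cube that agree with p on s. *)
  suff A_s (s : seq 'I_m) :
      A [ffun x : bool ^ m => x i || ~~ all (fun c => x c == p c) s].
    congr (A _): (A_s (enum 'I_m)); apply/ffunP => x; rewrite !ffunE.
    case: eqVneq => [->|/eqP neq_xp] /=.
      by rewrite pi0; apply/negbTE/negPn/allP => c _.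
    case: allP => [eq_xp|_]; last by rewrite orbT.
    by case: neq_xp; apply/ffunP => c; apply/eqP/eq_xp; rewrite mem_enum.
  elim: s => [|c s IHs].
    by congr (A _): (A_proj i); apply/ffunP => x; rewrite !ffunE /= orbF.
  have A_c := A_imp _ _ (A_proj c) IHs.
  have A_cc := A_imp _ _ A_c IHs.
  case pc: (p c); [congr (A _): A_c | congr (A _): A_cc];
    by apply/ffunP => x; rewrite !ffunE /= pc; case: (x i); case: (x c);
       case: (all _ s).
(* Zero set: the half-cube without the points of s. *)
suff A_s (s : seq (bool ^ m)) :
    A [ffun x : bool ^ m => x i || (x \in s)].
  congr (A _): (A_s (enum [pred x | f x])); apply/ffunP => x.
  rewrite !ffunE mem_enum inE; case xi: (x i) => //=.
  by rewrite le_if.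
elim: s => [|p s IHs].
  by congr (A _): (A_proj i); apply/ffunP => x; rewrite !ffunE orbF.
case pi: (p i).
  congr (A _): IHs; apply/ffunP => x; rewrite !ffunE inE.
  by case: eqVneq => [->|]; rewrite ?pi.
congr (A _): (A_imp _ _ (A_point p pi) IHs); apply/ffunP => x; rewrite !ffunE inE.
by case: eqVneq => //=; rewrite orbT.
Qed.

Lemma W_at_ones (k n : nat) (f : boolfun n.+1) :
  0 < k -> W k (omega f) -> f [ffun=> true].
Proof.
move=> k_gt0 /W_zeros_shareP share_f; case f1: (f _) => //.
have [_|c /(_ (Ordinal k_gt0))] := share_f (fun=> [ffun=> true]); first by [].
by rewrite ffunE.
Qed.

(** Identifying all variables of [f] gives the identity; a single substitution
both identifies the variables and adds inessential ones. *)
Lemma projections_of_fun_at_zeros (K : set Omega) (n : nat) (f : boolfun n.+1) :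
  equational_class K -> K (omega f) ->
  f [ffun=> false] = false -> f [ffun=> true] ->
  forall m (i : 'I_m.+1), K (omega (projection i)).
Proof.
move=> K_eq Kf f0 f1 m i; apply: K_eq Kf _; exists (fun=> i) => x /=.
rewrite ffunE; case: (x i); first by rewrite f1.
by rewrite f0.
Qed.


(** [W k.+1] is a clone, so a class inside it generates a clone inside it, and
[W k] is not. *)
Lemma zeros_covering (k : nat) (K : set Omega) :
  clone_interval (W k) K ->
  exists n (f : boolfun n.+1) (p : 'I_k.+1 -> bool ^ n.+1),
    [/\ K (omega f), forall i, f (p i) = false
      & forall c, exists i, p i c].
Proof.
move=> [_ K_gen]; apply: contrapT => no_p; apply: (@W_strict k).
rewrite -{1}K_gen; apply: smallest_sub (W_clone _) _ => -[n f] Kf.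
apply/W_zeros_shareP => p fp0; apply: contrapT => no_c; apply: no_p.
exists n, f, p; split=> // c; apply: contrapT => pc; apply: no_c.
by exists c => i; apply/negbTE/negP => pic; apply: pc; exists i.
Qed.

(** Let [a] be a zero of a member [h] of [K].  Substitute [f] for the variables
where [a] is 1 and [g] for the others.  The value is 1 where [f] and [g] agree,
[h a = 0] where [f] is 1 and [g] is 0, and [h] at the complement of [a] where
[f] is 0 and [g] is 1; the last value is 1, since [a] and its complement vanish
together nowhere and [2 <= k]. *)
Lemma implication_closed (k : nat) (K : set Omega) :
  1 < k -> clone_interval (W k) K ->
  (forall n (f : boolfun n.+1), K (omega f) -> f [ffun=> false]) ->
  forall n (f g : boolfun n.+1), K (omega f) -> K (omega g) ->
    K (omega [ffun x => f x ==> g x]).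
Proof.
move=> k_gt1 IK K_at0 n f g Kf Kg.
have [m [h [p [Kh hp0 _]]]] := zeros_covering _ _ IK.
case: IK => -[_ K_comp] K_gen.
have K_W : K `<=` W k by rewrite -K_gen; apply: sub_gen_smallest.
have h1 := W_at_ones _ _ _ (ltnW k_gt1) (K_W _ Kh).
have a0 := hp0 ord0; set a := p ord0 in a0.
have h_compl : h [ffun c => ~~ a c].
  case hN: (h _) => //.
  have /W_zeros_shareP share_h := K_W _ Kh.
  have [i|c ac] :=
      share_h (fun i => if val i == 0 then a else [ffun c => ~~ a c]).
    by case: ifP.
  have := ac (Ordinal (ltnW k_gt1)); have := ac (Ordinal k_gt1).
  by rewrite /= ffunE => /negbFE ->.
pose u c := if a c then f else g.
have -> : [ffun x => f x ==> g x] = composition h u.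
  apply/ffunP => x; rewrite !ffunE.
  case fx: (f x); case gx: (g x) => /=.
  - rewrite -[LHS]h1; congr (h _); apply/ffunP => c.
    by rewrite !ffunE /u; case: ifP; rewrite ?fx ?gx.
  - rewrite -[LHS]a0; congr (h _); apply/ffunP => c.
    by rewrite !ffunE /u; case: ifP; rewrite ?fx ?gx.
  - rewrite -[LHS]h_compl; congr (h _); apply/ffunP => c.
    by rewrite !ffunE /u; case: ifP; rewrite ?fx ?gx.
  - rewrite -[LHS](K_at0 _ _ Kh); congr (h _); apply/ffunP => c.
    by rewrite !ffunE /u; case: ifP; rewrite ?fx ?gx.
by apply: K_comp => // c; rewrite /u; case: ifP.
Qed.

(** Let [f] in [K] have the zeros [p 0, .., p k], vanishing together nowhere.
If at most one of the [G i x] is 1, send [x] to the zero of [f] with the index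
of that 1 (to [p 0] if there is none), and otherwise to the point of ones.
Coordinate [c] of this map is above the [i]-th argument as soon as [p i c] is
1, and such an [i] exists; so [implication_closed_W_infty] applies to each
coordinate. *)
Lemma at_least_two_closed (k : nat) (K : set Omega) :
  1 < k -> clone_interval (W k) K ->
  (forall n (f : boolfun n.+1), K (omega f) -> f [ffun=> false]) ->
  forall n (G : 'I_k.+1 -> boolfun n.+1), (forall i, K (omega (G i))) ->
    K (omega [ffun x => 1 < #|[pred i | G i x]|]).
Proof.
move=> k_gt1 IK K_at0 n G KG.
have K_imp := implication_closed _ _ k_gt1 IK K_at0.
have [m [f [p [Kf fp0 p_cover]]]] := zeros_covering _ _ IK.
case: IK => -[_ K_comp] K_gen.
have f1 : f [ffun=> true].
  by apply: W_at_ones (ltnW k_gt1) _; rewrite -K_gen; apply: sub_gen_smallest.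
pose true_index (y : bool ^ k.+1) := odflt ord0 [pick i | y i].
pose u c : boolfun k.+1 :=
  [ffun y : bool ^ k.+1 => (1 < #|[pred i | y i]|) || p (true_index y) c].
have Ku c : K (omega [ffun x => u c [ffun i => G i x]]).
  have [i pic] := p_cover c.
  pose A : set (boolfun k.+1) :=
    fun phi => K (omega [ffun x => phi [ffun i => G i x]]).
  apply: (implication_closed_W_infty _ A _ _ i) => [l|phi psi Aphi Apsi|y yi].
  - by congr (K (omega _)): (KG l); apply/ffunP => x; rewrite !ffunE.
  - congr (K (omega _)): (K_imp _ _ _ Aphi Apsi).
    by apply/ffunP => x; rewrite !ffunE.
  - rewrite ffunE; case: ltnP => //= y_le1.
    suff -> : true_index y = i by [].
    rewrite /true_index; case: pickP => [l yl|/(_ i)]; last by rewrite yi.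
    by apply: (card_le1_eqP y_le1).
have -> : [ffun x => 1 < #|[pred i | G i x]|] =
    composition f (fun c => [ffun x => u c [ffun i => G i x]]).
  apply/ffunP => x; rewrite !ffunE.
  have cardE : #|[pred i | [ffun i => G i x] i]| = #|[pred i | G i x]|.
    by apply: eq_card => i; rewrite !inE ffunE.
  case: ltnP => [G_gt1|G_le1].
    rewrite -[LHS]f1; congr (f _); apply/ffunP => c.
    by rewrite !ffunE cardE G_gt1.
  rewrite -[LHS](fp0 (true_index [ffun i => G i x])); congr (f _).
  by apply/ffunP => c; rewrite !ffunE cardE ltnNge G_le1.
exact: K_comp.
Qed.

(** * Interpolation and finiteness *)

(** Induction on the number of points where [F] has to be matched.  For a list
of more than [k] points, take members [G i] of [K] that are right on all its
points but the [i]-th one, for [k+1] indices [i].  At each point of the list at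
most one of them is wrong, so at most one takes the value 1 where [F] is 0, and
at least [k >= 2] take the value 1 where [F] is 1. *)
Lemma interval_interpolation (k : nat) (K : set Omega) :
  1 < k -> clone_interval (W k) K ->
  forall n (F : boolfun n.+1),
    (forall p : 'I_k -> bool ^ n.+1,
       exists2 g : boolfun n.+1, K (omega g) & forall i, g (p i) = F (p i)) ->
    K (omega F).
Proof.
move=> k_gt1 IK n F F_loc.
have K_W : K `<=` W k by case: IK => _ <-; apply: sub_gen_smallest.
have [[m [f Kf f0]]|K_at0] := pselect (exists m, exists2 f : boolfun m.+1,
    K (omega f) & f [ffun=> false] = false).
  (* Here K is W k, and belonging to W k is a condition on k points. *)
  have [[K_eq K_comp] K_gen] := IK.
  have f1 := W_at_ones _ _ _ (ltnW k_gt1) (K_W _ Kf).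
  have K_clone : clone K.
    by split=> //; apply: projections_of_fun_at_zeros K_eq Kf f0 f1.
  rewrite -(smallest_id K_clone) -/(clone_generated K) K_gen.
  apply/W_zeros_shareP => p Fp0; have [g Kg gF] := F_loc p.
  have /W_zeros_shareP share_g := K_W _ Kg.
  by apply: share_g => i; rewrite gF.
have {}K_at0 m (f : boolfun m.+1) : K (omega f) -> f [ffun=> false].
  by move=> Kf; case f0: (f _) => //; case: K_at0; exists m, f.
have K_two := at_least_two_closed _ _ k_gt1 IK K_at0.
suff interpolate N (s : seq (bool ^ n.+1)) : uniq s -> size s <= N ->
    exists2 g : boolfun n.+1, K (omega g) & {in s, forall x, g x = F x}.
  have [g Kg gF] := interpolate _ _ (enum_uniq {: bool ^ n.+1}) (leqnn _).
  congr (K (omega _)): Kg; apply/ffunP => x.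
  by rewrite gF // mem_enum.
elim: N s => [|N IHN] s s_uniq s_size.
  move: s_size; rewrite leqn0 size_eq0 => /eqP ->.
  by have [g Kg _] := F_loc (fun=> [ffun=> false]); exists g.
have [s_le|s_gt] := leqP (size s) k.
  have [g Kg gF] := F_loc (fun i => nth [ffun=> false] s i).
  exists g => // x s_x.
  have lt_xk : index x s < k by apply: leq_trans s_le; rewrite index_mem.
  by have := gF (Ordinal lt_xk); rewrite /= nth_index.
(* The list has more than k points, so the default value is never used. *)
pose q (i : 'I_k.+1) := nth [ffun=> false] s i.
have q_s i : q i \in s.
  by apply: mem_nth; apply: leq_trans s_gt; rewrite ltn_ord.
have q_inj i j : q i = q j -> i = j.
  move=> /eqP; rewrite nth_uniq => [/eqP/val_inj|||] //;
    by apply: leq_trans s_gt; rewrite ltn_ord.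
have G_ex i : exists G : boolfun n.+1,
    K (omega G) /\ {in rem (q i) s, forall x, G x = F x}.
  have [||g Kg gF] := IHN (rem (q i) s); first exact: rem_uniq.
    by rewrite size_rem // -ltnS prednK // (leq_ltn_trans _ s_gt).
  by exists g.
have [G KG] := fin_all_exists G_ex.
exists [ffun x => 1 < #|[pred i | G i x]|].
  by apply: K_two => i; case: (KG i).
move=> x s_x; have G_x i : q i != x -> G i x = F x.
  by move=> neq; apply: (KG i).2; rewrite mem_rem_uniq // inE eq_sym neq.
have q_le1 : #|[pred i | q i == x]| <= 1.
  by apply/card_le1_eqP => i j; rewrite !inE => /eqP <- /eqP /q_inj ->.
rewrite ffunE; case Fx: (F x).
  rewrite (@leq_trans #|[predC [pred i | q i == x]]|) //.
    apply: leq_trans k_gt1 _; rewrite -ltnS.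
    apply: (@leq_trans (#|[pred i | q i == x]| + #|[predC [pred i | q i == x]]|)).
      by rewrite cardC card_ord.
    exact: leq_add q_le1 (leqnn _).
  by apply: subset_leq_card; apply/fintype.subsetP => i; rewrite !inE => /G_x ->.
apply/negbTE; rewrite -leqNgt; apply: leq_trans q_le1.
apply: subset_leq_card; apply/fintype.subsetP => i; rewrite !inE.
by apply: contraTT => /G_x ->; rewrite Fx.
Qed.

(** The values of [F] at [k] points only involve the function obtained from [F]
by identifying the variables whose columns in the table of these points
coincide.  It is a subfunction of [F] of arity bounded in terms of [k], and
[F] can be recovered from it on these points by reinserting, for each column, a
variable that has it. *)
Lemma interval_sub_of_trace (k M : nat) (K1 K2 : set Omega) :
  1 < k -> #|{: bool ^ k}| <= M.+1 ->
  clone_interval (W k) K1 -> clone_interval (W k) K2 ->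
  (forall f : boolfun M.+1, K1 (omega f) -> K2 (omega f)) -> K1 `<=` K2.
Proof.
move=> k_gt1 le_kM [[K1_eq _] _] IK2 sub12 [n F] K1F.
apply: (interval_interpolation _ _ k_gt1 IK2) => p.
pose row (c : 'I_n.+1) : bool ^ k := [ffun i => p i c].
pose sigma (c : 'I_n.+1) : 'I_M.+1 := widen_ord le_kM (enum_rank (row c)).
pose tau (d : 'I_M.+1) : 'I_n.+1 := odflt ord0 [pick c | sigma c == d].
have row_tau c : row (tau (sigma c)) = row c.
  rewrite /tau; case: pickP => [c' /eqP|/(_ c)]; last by rewrite eqxx.
  by move=> /(congr1 val) /= /ord_inj /enum_rank_inj.
pose F1 : boolfun M.+1 := [ffun y : bool ^ M.+1 => F [ffun c => y (sigma c)]].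
pose F2 : boolfun n.+1 := [ffun x : bool ^ n.+1 => F1 [ffun d => x (tau d)]].
have K2F1 : K2 (omega F1).
  by apply/sub12/(K1_eq _ _ K1F); exists sigma => y; rewrite ffunE.
exists F2.
  by apply: IK2.1.1 K2F1 _; exists tau => x; rewrite ffunE.
move=> i; rewrite !ffunE; congr (F _); apply/ffunP => c; rewrite !ffunE.
by have /ffunP/(_ i) := row_tau c; rewrite !ffunE.
Qed.

Theorem theorem6p5 (k : nat) (hk : (2 <= k)%N) :
  finite_set (clone_interval (W k)) /\
  `I_(k.+1) #<= clone_interval (W k).
Proof.
split.
  pose M := #|{: bool ^ k}|.
  pose trace (K : set Omega) : {ffun boolfun M.+1 -> bool} :=
    [ffun f => `[< K (omega f) >]].
  have trace_sub K1 K2 : clone_interval (W k) K1 -> clone_interval (W k) K2 ->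
      trace K1 = trace K2 -> K1 `<=` K2.
    move=> IK1 IK2 /ffunP eq12; apply: interval_sub_of_trace hk (leqnSn M) IK1 IK2 _.
    by move=> f /asboolP; have := eq12 f; rewrite !ffunE => -> /asboolP.
  rewrite -(eq_finite_set (inj_card_eq (f := trace) _)); first exact: finite_finset.
  move=> K1 K2 /set_mem IK1 /set_mem IK2 eq12.
  by apply/seteqP; split; apply: trace_sub.
rewrite -(card_le_eql (inj_card_eq (f := W_ones k) _)).
  apply: subset_card_le => _ [j lt_jk <-]; split; first exact: W_ones_cc.
  exact: W_ones_generates (ltnW hk).
move=> i j _ _ eq_ij.
by case: (ltngtP i j) => // /(W_ones_separated k); rewrite eq_ij.
Qed.
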